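(* Let $n \ge 2$ be an integer, let $\vec{v} = (v_1,\ldots,v_n) \in \mathbb{C}^n$, let $\mathbf{D} = \operatorname{diag}(v_1,\ldots,v_n)$ be the associated $n\times n$ diagonal matrix, regarded as a linear endomorphism of $\mathbb{C}^n$, and let $s,t \in (\mathbb{R}\setminus\{0\}) \cup \{+\infty,-\infty\}$. Let $\|\mathbf{D}\|_{s,t}$ denote the operator weight of $\mathbf{D} : (\mathbb{C}^n,\|\cdot\|_s) \to (\mathbb{C}^n,\|\cdot\|_t)$ with respect to the Hölder weights $\|\cdot\|_s$ and $\|\cdot\|_t$. Then all possible cases are covered by the following list, and: (A) $\|\mathbf{D}\|_{s,t} = \infty$ if $s<0<t$ and $\vec{v}\neq\vec{0}$; (B) $\|\mathbf{D}\|_{s,t} = \|\vec{v}\|_t$ if $\vec{v}=\vec{0}$, or ($t<0$ and $\prod_{i=1}^n v_i = 0$), or $s=\infty$; (C) $\|\mathbf{D}\|_{s,t} = \|\vec{v}\|_{\frac{s\cdot t}{s-t}}$ if ($-\infty<t<s<0$ and $\prod_{i=1}^n v_i\neq 0$), or $0<t<s<\infty$, or $-\infty<t<0<s<\infty$; (D) $\|\mathbf{D}\|_{s,t} = \|\vec{v}\|_\infty$ if ($s\le t<0$ and $\prod_{i=1}^n v_i\neq 0$), or $0<s\le t$; (E) $\|\mathbf{D}\|_{s,t} = \|\vec{v}\|_{-s}$ if $t=-\infty$ and $\prod_{i=1}^n v_i\neq 0$.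
   Context: Hölder weights on $\mathbb{C}^n$: for $\vec{x}=(x_1,\ldots,x_n)\in\mathbb{C}^n$, - for $p\in(0,\infty)$: $\|\vec{x}\|_p := \left(\sum_{i=1}^n |x_i|^p\right)^{1/p}$; - for $p\in(-\infty,0)$: $\|\vec{x}\|_p := \left(\sum_{i=1}^n |x_i|^p\right)^{1/p}$ if $\prod_{i=1}^n x_i\neq 0$, and $\|\vec{x}\|_p := 0$ if $\prod_{i=1}^n x_i=0$; - $\|\vec{x}\|_\infty := \max_{1\le i\le n}|x_i|$ and $\|\vec{x}\|_{-\infty} := \min_{1\le i\le n}|x_i|$. Operator weight: for a linear map $F:(X,\|\cdot\|_X)\to(Y,\|\cdot\|_Y)$ between complex vector spaces, each equipped with a map to $[0,\infty]$ that vanishes at $\vec 0$ and satisfies $\|z\vec{x}\|=|z|\,\|\vec{x}\|$ for all $z \in \mathbb{C}$, the operator weight is $\|F\| := \inf\{C>0 \mid \forall \vec{x}\in X:\ \|F(\vec{x})\|_Y\le C\cdot\|\vec{x}\|_X\}$, with $\inf\emptyset=\infty$. In particular $\|\mathbf{D}\|_{s,t} = \inf\{C>0 \mid \forall \vec{x}\in\mathbb{C}^n:\ \|\mathbf{D}\vec{x}\|_t\le C\|\vec{x}\|_s\}$. The convention $-(\pm\infty)=\mp\infty$ is used for the index $-s$ in (E). *)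

(* Defs.v *)
From mathcomp Require Export all_boot all_order all_algebra.
From mathcomp Require Export complex.
From mathcomp Require Export all_classical all_reals all_analysis.
Set Implicit Arguments.
Unset Strict Implicit.
Unset Printing Implicit Defensive.
Import Order.TTheory GRing.Theory Num.Theory.
Local Open Scope classical_set_scope.
Local Open Scope complex_scope.
Local Open Scope ring_scope.

(* The modulus [Normc.normc z] is the real-valued one; [`|z|] lives in [R[i]]. *)

Definition is_weight (R : realType) (X : lmodType R[i]) (w : X -> \bar R) :=
  [/\ forall x, (0 <= w x)%E,
      w 0 = 0%E &
      forall (z : R[i]) x, w (z *: x) = ((Normc.normc z)%:E * w x)%E].

(* Meant for maps satisfying [is_weight]; [ereal_inf] of the empty set is [+oo]. *)
Definition operator_weight (R : realType) (X Y : lmodType R[i])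
    (wX : X -> \bar R) (wY : Y -> \bar R) (F : {linear X -> Y}) : \bar R :=
  ereal_inf [set C%:E | C in [set C : R |
    0 < C /\ forall x : X, (wY (F x) <= C%:E * wX x)%E]].

(* A total function of the exponent [p]; the value at [p = 0] is irrelevant.
   The explicit zero case for [p < 0] matters: [powR 0 p = 0] when [p != 0]. *)
Definition holder (R : realType) (n : nat) (p : \bar R) (x : 'cV[R[i]]_n) :
    \bar R :=
  match p with
  | r%:E => if (r < 0) && (\prod_i x i 0 == 0) then 0%E
            else ((\sum_i Normc.normc (x i 0) `^ r) `^ r^-1)%:E
  | +oo%E => \big[maxe/0%E]_i (Normc.normc (x i 0))%:E
  | -oo%E => \big[mine/+oo%E]_i (Normc.normc (x i 0))%:E
  end.

Section HolderWeight.
Variables (R : realType) (n : nat).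
Implicit Types (z : R[i]) (x : 'cV[R[i]]_n).

Let normc_ge0 z : 0 <= Normc.normc z.
Proof. by case: z => a b; rewrite /Normc.normc sqrtr_ge0. Qed.

Lemma holder_weight (p : \bar R) : (0 < n)%N -> p != 0%E ->
  is_weight (@holder R n p).
Proof.
move=> n0 p0.
have ge0 x : (0 <= holder p x)%E.
  case: p p0 => [r||] _ /=.
  - by case: ifP => // _; rewrite lee_fin powR_ge0.
  - by elim/big_ind: _ => // [a b a0 b0|i _]; rewrite ?le_max ?a0 ?lee_fin.
  - by elim/big_ind: _ => // [a b a0 b0|i _]; rewrite ?le_min ?a0 ?lee_fin.
suff hZ z x : holder p (z *: x) = ((Normc.normc z)%:E * holder p x)%E.
  split=> //; have := hZ 0 0; by rewrite scaler0 Normc.normc0 mul0e.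
have zpos : (0 <= (Normc.normc z)%:E)%E by rewrite lee_fin.
case: p p0 {ge0} => [r||] p0 /=.
- have r0 : r != 0 by apply: contraNneq p0 => ->.
  under eq_bigr do rewrite mxE.
  under [X in (X `^ _)%:E]eq_bigr do rewrite mxE Normc.normcM powRM//.
  rewrite big_split/= prodr_const card_ord mulf_eq0 expf_eq0 n0 /=.
  have [->|z0] := eqVneq z 0.
    rewrite Normc.normc0 mul0e andbT; case: ifP => // /negbT.
    rewrite -leNgt => rge0; rewrite powR0// -mulr_sumr mul0r powR0 ?invr_eq0//.
  case: ifP => _ /=; first by rewrite mule0.
  rewrite -mulr_sumr powRM ?powR_ge0//; last first.
    by apply: sumr_ge0 => i _; exact: powR_ge0.
  by rewrite -powRrM mulfV// powRr1.
- under eq_bigr do rewrite mxE Normc.normcM EFinM.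
  by rewrite -(big_morph _ (fun a b => maxe_pMr a b _ zpos) (mule0 _)).
- under eq_bigr do rewrite mxE Normc.normcM EFinM.
  move: zpos; rewrite le_eqVlt => /predU1P[z0|z0].
    rewrite -z0 mul0e; case: n x n0 => // m x _.
    rewrite big_ord_recl mul0e; apply/min_idPl.
    by elim/big_ind: _ => // [a b a0 b0|i _]; rewrite ?le_min ?a0 ?mul0e.
  by rewrite -(big_morph _ (fun a b => mine_pMr a b _ (ltW z0)) (gt0_muley z0)).
Qed.
End HolderWeight.

(* Main.v *)
Require Import Defs.
From mathcomp Require Import ring.
Set Implicit Arguments.
Unset Strict Implicit.
Unset Printing Implicit Defensive.
Import Order.TTheory GRing.Theory Num.Theory.
Local Open Scope complex_scope.
Local Open Scope ring_scope.

(** All weights depend only on the moduli [a] of [v] and [y] of the argument, so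
    everything is about [rholder t (a * y) <= c * rholder s y] for nonnegative
    real vectors. With [1/t = 1/p + 1/s], case (C) is Hölder's inequality, in its
    usual form if [t > 0] and reversed if [t < 0], with equality at
    [y = a^(p/s)]. Case (D) bounds [a * y] by [max a] times [y] and uses that
    the weight decreases in the exponent on each half-line; on the negative
    half-line this follows from the duality between [p, a] and [-p, 1/a], which
    also gives (E) with the extremal vector [1/a]. *)

(** * Powers with real exponents *)

Section PowR.
Context {R : realType}.
Implicit Types x y r p q : R.

Lemma powRK x r : 0 <= x -> r != 0 -> (x `^ r) `^ r^-1 = x.
Proof. by move=> x0 r0; rewrite -powRrM mulfV// powRr1. Qed.

Lemma powRVK x r : 0 <= x -> r != 0 -> (x `^ r^-1) `^ r = x.
Proof. by move=> x0 r0; rewrite -powRrM mulVf// powRr1. Qed.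

(** Turns a bound with Hölder exponents [r / p] and [r / q] into a product of two weights when the
    [r]-th root is taken. *)
Lemma powR_prodK x y r p q : r != 0 -> 0 <= x -> 0 <= y ->
  (x `^ (r / p) * y `^ (r / q)) `^ r^-1 = x `^ p^-1 * y `^ q^-1.
Proof.
move=> r0 x0 y0; rewrite powRM ?powR_ge0// -!powRrM.
by rewrite (mulrAC r p^-1) (mulrAC r q^-1) !mulfV// !mul1r.
Qed.

Lemma le_powR x y r : 0 <= r -> 0 <= x -> x <= y -> x `^ r <= y `^ r.
Proof.
move=> r0 x0 xy; apply: ge0_ler_powR => //; rewrite nnegrE//.
exact: le_trans xy.
Qed.

Lemma le_powR_neg x y r : r <= 0 -> 0 < x -> x <= y -> y `^ r <= x `^ r.
Proof.
move=> r0 x0 xy; have y0 : 0 < y by apply: lt_le_trans xy.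
rewrite -(opprK r) powRN (powRN x) lef_pV2 ?posrE ?powR_gt0//.
by apply: le_powR; rewrite ?oppr_ge0// ltW.
Qed.

End PowR.

(** * Hölder weights of real vectors: duality and monotonicity *)

Section RealHolder.
Context {R : realType} {n : nat}.
Implicit Types (a b y : 'I_n -> R) (p s t : \bar R) (r : R).

(* The initial value of the minimum only serves to dominate the entries: it is a
   finite substitute for [+oo]. *)
Definition rholder p a : R :=
  match p with
  | r%:E => if (r < 0) && [exists i, a i == 0] then 0
            else (\sum_i a i `^ r) `^ r^-1
  | +oo%E => \big[Num.max/0]_i a i
  | -oo%E => \big[Num.min / \big[Num.max/0]_i a i]_i a i
  end.

Lemma rholder_ge0 p a : (forall i, 0 <= a i) -> 0 <= rholder p a.
Proof.
move=> a0; have m0 : 0 <= \big[Num.max/0]_i a i by exact: bigmax_ge_id.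
case: p => [r||] //=; first by case: ifP => // _; exact: powR_ge0.
by apply: le_bigmin.
Qed.

Lemma le_rholdery a i : a i <= rholder +oo%E a.
Proof. exact: le_bigmax. Qed.

Lemma rholdery_le a r : 0 <= r -> (forall i, a i <= r) -> rholder +oo%E a <= r.
Proof. by move=> r0 ar; apply: bigmax_le. Qed.

Lemma rholderNy_le a i : rholder -oo%E a <= a i.
Proof. exact: bigmin_le. Qed.

Lemma le_rholderNy a r : (0 < n)%N -> (forall i, r <= a i) ->
  r <= rholder -oo%E a.
Proof.
move=> n0 ra; apply: le_bigmin => //.
exact: le_trans (ra (Ordinal n0)) (le_rholdery _ _).
Qed.

Lemma rholder_zero p a i : (forall i, 0 <= a i) -> (p < 0)%E -> a i = 0 ->
  rholder p a = 0.
Proof.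
move=> a0; case: p => [r| |] //=.
  rewrite lte_fin => -> ai; case: ifP => //= /negbT/'exists_eqP; case.
  by exists i; rewrite ai.
move=> _ ai; apply/eqP; rewrite eq_le (rholder_ge0 -oo%E)//= andbT.
by rewrite -ai; exact: bigmin_le.
Qed.

Lemma rholder_fin_neg r a : (forall i, 0 < a i) ->
  rholder r%:E a = (\sum_i a i `^ r) `^ r^-1.
Proof.
move=> a0 /=; case: ifP => // /andP[_ /'exists_eqP[i ai]].
by have := a0 i; rewrite ai ltxx.
Qed.

Lemma rholder_fin_pos r a : 0 < r -> rholder r%:E a = (\sum_i a i `^ r) `^ r^-1.
Proof. by move=> /= r0; rewrite ltNge (ltW r0). Qed.

Lemma sum_powR_ge0 r a : 0 <= \sum_i a i `^ r.
Proof. by apply: sumr_ge0 => i _; exact: powR_ge0. Qed.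

Lemma le_sum_powR r a i : a i `^ r <= \sum_j a j `^ r.
Proof.
rewrite (bigD1 i)//= lerDl; apply: sumr_ge0 => j _; exact: powR_ge0.
Qed.

Lemma sum_powR_gt0 r a i : 0 < a i -> 0 < \sum_j a j `^ r.
Proof.
by move=> ai; apply: lt_le_trans (le_sum_powR r a i); exact: powR_gt0.
Qed.

Lemma rholder_gt0 p a : (0 < n)%N -> (forall i, 0 < a i) -> 0 < rholder p a.
Proof.
move=> n0 a0; have [a00 m0] : (forall i, 0 <= a i) /\ 0 < rholder +oo%E a.
  split=> [i|]; first exact: ltW.
  exact: lt_le_trans (a0 (Ordinal n0)) (le_rholdery _ _).
case: p => [r||] //.
  by rewrite rholder_fin_neg// powR_gt0// (sum_powR_gt0 r (a0 (Ordinal n0))).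
by rewrite /=; elim/big_ind: _ => // x y x0 y0; rewrite lt_min x0.
Qed.

(** Inverting the entries and negating the exponent keeps the power sum and flips only the outer
    exponent; for infinite exponents, inversion exchanges maximum and minimum. *)
Lemma rholderV p a : (0 < n)%N -> (forall i, 0 < a i) ->
  rholder (- p)%E (fun i => (a i)^-1) = (rholder p a)^-1.
Proof.
move=> n0 a0; have b0 i : 0 < (a i)^-1 by rewrite invr_gt0.
have pi q : 0 < rholder q a by exact: rholder_gt0.
have piV q : 0 < rholder q (fun i => (a i)^-1) by exact: rholder_gt0.
case: p => [r||].
- rewrite -EFinN (rholder_fin_neg _ a0) (rholder_fin_neg _ b0) invrN powRN.
  congr (_ `^ _)^-1.
  apply: eq_bigr => i _; rewrite powRN -(powR_inv1 (ltW (a0 i))).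
  by rewrite -powRrM mulN1r powRN invrK.
- apply/eqP; rewrite eq_le; apply/andP; split.
    rewrite -[leLHS]invrK lef_pV2 ?posrE ?invr_gt0//.
    apply: rholdery_le => [|i]; first by rewrite invr_ge0 ltW.
    by rewrite -[leLHS]invrK lef_pV2 ?posrE ?invr_gt0//; exact: rholderNy_le.
  apply: le_rholderNy => // i; rewrite lef_pV2 ?posrE//; exact: le_rholdery.
- apply/eqP; rewrite eq_le; apply/andP; split.
    apply: rholdery_le => [|i]; first by rewrite invr_ge0 ltW.
    by rewrite lef_pV2 ?posrE//; exact: rholderNy_le.
  rewrite -[leRHS]invrK lef_pV2 ?posrE ?invr_gt0//.
  apply: le_rholderNy => // i; rewrite -[leRHS]invrK lef_pV2 ?posrE ?invr_gt0//.
  exact: (le_rholdery (fun i => (a i)^-1)).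
Qed.

Lemma rholder_le p a b : (0 < n)%N -> p != 0%E -> (forall i, 0 <= a i <= b i) ->
  rholder p a <= rholder p b.
Proof.
move=> n0 p0 ab; have a0 i : 0 <= a i by case/andP: (ab i).
have lab i : a i <= b i by case/andP: (ab i).
have b0 i : 0 <= b i by exact: le_trans (a0 i) (lab i).
(* With a zero entry, a negative [p] gives 0 on the left and a positive one involves only increasing
   powers or a maximum. Without one, a negative exponent reverses the order twice, in the entries
   and in the outer root. *)
have [[i ai]|/forallNP az] := pselect (exists i, a i = 0).
  case: (ltP p 0%E) => pn; first by rewrite (rholder_zero a0 pn ai) rholder_ge0.
  have {pn}pp : (0 < p)%E by rewrite lt_def p0.
  case: p p0 pp => [r p0|_ _|//].
    rewrite lte_fin => r0; rewrite !(rholder_fin_pos _ r0).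
    apply: le_powR; rewrite ?invr_ge0 ?(ltW r0)// ?sum_powR_ge0//.
    by apply: ler_sum => j _; apply: le_powR => //; exact: ltW.
  apply: rholdery_le => [|j]; first exact: rholder_ge0.
  exact: le_trans (lab j) (le_rholdery _ _).
have {az}a1 i : 0 < a i by rewrite lt_def a0 andbT; apply/eqP; exact: az.
have b1 i : 0 < b i by exact: lt_le_trans (a1 i) (lab i).
case: p p0 => [r p0|_|_].
- rewrite (rholder_fin_neg r a1) (rholder_fin_neg r b1); have [r0|r0] := leP 0 r.
    apply: le_powR; rewrite ?invr_ge0// ?sum_powR_ge0//.
    by apply: ler_sum => j _; exact: le_powR.
  apply: le_powR_neg; rewrite ?invr_le0 ?(ltW r0)//.
    exact: sum_powR_gt0 (b1 (Ordinal n0)).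
  by apply: ler_sum => j _; apply: le_powR_neg => //; exact: ltW.
- apply: rholdery_le => [|j]; first exact: rholder_ge0.
  exact: le_trans (lab j) (le_rholdery _ _).
- apply: le_rholderNy => // j.
  exact: le_trans (rholderNy_le _ _) (lab j).
Qed.

(** Each entry is at most the [s]-weight S, so a_i^t <= S^(t-s) a_i^s for finite t, and these bounds
    sum to S^t. *)
Let le_exponent_pos s t a : (forall i, 0 <= a i) -> (0 < s <= t)%E ->
  rholder t a <= rholder s a.
Proof.
move=> a0 /andP[]; case: s => [s||]//; last by case: t.
rewrite lte_fin => s0; have sn0 : s != 0 by rewrite gt_eqF.
have S0 := sum_powR_ge0 s a.
have aS i : a i <= (\sum_i a i `^ s) `^ s^-1.
  rewrite -[leLHS](powRK (a0 i) sn0); apply: le_powR; rewrite ?powR_ge0//.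
    by rewrite invr_ge0 ltW.
  exact: le_sum_powR.
rewrite (rholder_fin_pos a s0); case: t => [t||]//; last first.
  by move=> _; apply: rholdery_le => [|i] //; exact: powR_ge0.
rewrite lee_fin => st; have t0 : 0 < t by exact: lt_le_trans st.
have tn0 : t != 0 by rewrite gt_eqF.
rewrite (rholder_fin_pos a t0); set S := (X in _ <= X) in aS *.
have S1 : 0 <= S by exact: powR_ge0.
rewrite -[leRHS](powRK S1 tn0); apply: le_powR; rewrite ?sum_powR_ge0//.
  by rewrite invr_ge0 ltW.
have split_t x : x `^ t = x `^ (t - s) * x `^ s.
  by rewrite -powRD ?subrK// (negbTE tn0).
rewrite (split_t S) {2}/S powRVK// mulr_sumr; apply: ler_sum => i _.
by rewrite split_t ler_wpM2r ?powR_ge0// le_powR// subr_ge0.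
Qed.

Lemma rholder_le_exponent s t a : (0 < n)%N -> (forall i, 0 <= a i) ->
  (0 < s <= t)%E || (s <= t < 0)%E -> rholder t a <= rholder s a.
Proof.
move=> n0 a0 /orP[|/andP[st tn]]; first exact: le_exponent_pos.
(* Duality needs invertible entries; with a zero entry the left-hand weight is 0. *)
have [[i ai]|/forallNP az] := pselect (exists i, a i = 0).
  by rewrite (rholder_zero a0 tn ai) rholder_ge0.
have {az}a1 i : 0 < a i by rewrite lt_def a0 andbT; apply/eqP; exact: az.
have sn := le_lt_trans st tn.
rewrite -[leLHS]invrK -[leRHS]invrK -(rholderV t n0 a1) -(rholderV s n0 a1).
have b1 i : 0 < (a i)^-1 by rewrite invr_gt0.
rewrite lef_pV2 ?posrE ?rholder_gt0//; apply: le_exponent_pos => [i|].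
  exact: ltW.
by rewrite oppe_gt0 tn leeN2.
Qed.


(** * Hölder's inequality, its reversed form and the equality case *)

Lemma hoelder_sum (th : R) (u w : 'I_n -> R) : 0 < th < 1 ->
  (forall i, 0 <= u i) -> (forall i, 0 <= w i) ->
  \sum_i u i `^ th * w i `^ (1 - th) <=
  (\sum_i u i) `^ th * (\sum_i w i) `^ (1 - th).
Proof.
move=> /andP[th0 th1] u0 w0; have th2 : 0 < 1 - th by rewrite subr_gt0.
set U := \sum_i u i; set W := \sum_i w i.
have U0 : 0 <= U by exact: sumr_ge0.
have W0 : 0 <= W by exact: sumr_ge0.
have [U1|U1] := eqVneq U 0.
  rewrite big1 ?mulr_ge0 ?powR_ge0// => i _.
  by rewrite (psumr_eq0P _ U1)// powR0 ?mul0r// gt_eqF.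
have [W1|W1] := eqVneq W 0.
  rewrite big1 ?mulr_ge0 ?powR_ge0// => i _.
  by rewrite (psumr_eq0P _ W1)// powR0 ?mulr0// gt_eqF.
(* Young's inequality for the terms normalised by their sums; over all [i] its right sides add up to
   1. *)
have young i : (u i / U) `^ th * (w i / W) `^ (1 - th) <=
    u i / U * th + w i / W * (1 - th).
  have uU : 0 <= u i / U by rewrite divr_ge0.
  have wW : 0 <= w i / W by rewrite divr_ge0.
  have := @conjugate_powR R _ _ th^-1 (1 - th)^-1
    (powR_ge0 (u i / U) th) (powR_ge0 (w i / W) (1 - th)).
  by rewrite !invr_gt0 !invrK !powRK ?gt_eqF//; apply => //; rewrite addrC subrK.
have -> : U `^ th * W `^ (1 - th) = U `^ th * W `^ (1 - th) *
    \sum_i (u i / U * th + w i / W * (1 - th)).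
  by rewrite big_split/= -!mulr_suml !mulfV// !mul1r addrC subrK mulr1.
rewrite mulr_sumr; apply: ler_sum => i _.
apply: le_trans (ler_wpM2l _ (young i)); last by rewrite mulr_ge0 ?powR_ge0.
rewrite mulrACA -!powRM ?divr_ge0//.
by rewrite ![_ * (_ / _)]mulrC !divfK.
Qed.

(** Hölder with exponent 1/th for the factorisation u = (u^th w^(1-th))^(1/th) w^(1-1/th); then
    raise to the power [th] and move the power of W across. *)
Lemma reverse_hoelder_sum (th : R) (u w : 'I_n -> R) : (0 < n)%N -> 1 < th ->
  (forall i, 0 < u i) -> (forall i, 0 < w i) ->
  (\sum_i u i) `^ th * (\sum_i w i) `^ (1 - th) <=
  \sum_i u i `^ th * w i `^ (1 - th).
Proof.
move=> n0 th1 u0 w0; have th0 : 0 < th by exact: lt_trans th1.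
have thn0 : th != 0 by rewrite gt_eqF.
set X := (X in _ <= X); set U := \sum_i u i; set W := \sum_i w i.
have W0 : 0 < W.
  rewrite /W (bigD1 (Ordinal n0))//= ltr_wpDr//.
  by apply: sumr_ge0 => i _; exact: ltW.
have X0 : 0 <= X by apply: sumr_ge0 => i _; rewrite mulr_ge0 ?powR_ge0.
have : U <= X `^ th^-1 * W `^ (1 - th^-1).
  rewrite [U](_ : _ = \sum_i (u i `^ th * w i `^ (1 - th)) `^ th^-1 *
      w i `^ (1 - th^-1)); last first.
    apply: eq_bigr => i _; rewrite powRM ?powR_ge0// powRK ?(ltW (u0 i))//.
    rewrite -powRrM -mulrA -powRD ?(gt_eqF (w0 i)) ?implybT//.
    by rewrite (_ : _ + _ = 0) ?powRr0 ?mulr1//; field.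
  apply: hoelder_sum => [|i|i]; rewrite ?mulr_ge0 ?powR_ge0// ?ltW//.
  by rewrite invr_gt0 th0 invf_lt1.
have U0 : 0 <= U by apply: sumr_ge0 => i _; exact: ltW.
move=> /(le_powR (ltW th0) U0).
rewrite powRM ?powR_ge0// powRVK// -powRrM.
rewrite (_ : _ * th = - (1 - th)); last by field.
by rewrite powRN -ler_pdivlMr ?invr_gt0 ?powR_gt0// invrK.
Qed.

Lemma rholder_hoelder_pos (p s t : R) a y : 0 < p -> 0 < s -> 0 < t ->
  t^-1 = p^-1 + s^-1 -> (forall i, 0 <= a i) -> (forall i, 0 <= y i) ->
  rholder t%:E (fun i => a i * y i) <= rholder p%:E a * rholder s%:E y.
Proof.
move=> p0 s0 t0 e a0 y0.
rewrite (rholder_fin_pos _ p0) (rholder_fin_pos _ s0) (rholder_fin_pos _ t0).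
have [pn sn tn] : [/\ p != 0, s != 0 & t != 0] by rewrite !gt_eqF.
(* The relation [e] makes t/p and t/s the complementary exponents [th] and [1 - th], applied to a^p
   and y^s. *)
have ts : 1 - t / p = t / s.
  by rewrite -(mulfV tn) e mulrDr addrAC subrr add0r.
have tp : 0 < t / p < 1.
  by rewrite divr_gt0//= -subr_gt0 ts divr_gt0.
have := hoelder_sum tp (fun i => powR_ge0 (a i) p) (fun i => powR_ge0 (y i) s).
rewrite ts => H.
have {}H : \sum_i (a i * y i) `^ t <= (\sum_i a i `^ p) `^ (t / p) *
    (\sum_i y i `^ s) `^ (t / s).
  apply: le_trans H; apply: ler_sum => i _.
  rewrite powRM// -!powRrM mulrCA mulfV// mulr1 mulrCA mulfV// mulr1//.
have ti : 0 <= t^-1 by rewrite invr_ge0 ltW.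
rewrite -(powR_prodK p s tn (sum_powR_ge0 _ _) (sum_powR_ge0 _ _)).
exact: le_powR ti (sum_powR_ge0 _ _) H.
Qed.

(** Here t/s > 1, so the reversed inequality applies to y^s and a^p, and the negative outer power
    1/t reverses it back. *)
Lemma rholder_hoelder_neg (p s t : R) a y : (0 < n)%N ->
  0 < p -> s < 0 -> t < 0 ->
  t^-1 = p^-1 + s^-1 -> (forall i, 0 < a i) -> (forall i, 0 < y i) ->
  rholder t%:E (fun i => a i * y i) <= rholder p%:E a * rholder s%:E y.
Proof.
move=> n0 p0 s0 t0 e a0 y0.
have ay0 i : 0 < a i * y i by rewrite mulr_gt0.
rewrite (rholder_fin_neg _ a0) (rholder_fin_neg _ y0) (rholder_fin_neg _ ay0).
have [pn sn tn] : [/\ p != 0, s != 0 & t != 0].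
  by rewrite gt_eqF// !lt_eqF.
have tp : 1 - t / s = t / p.
  by rewrite -(mulfV tn) e mulrDr addrK.
have ts : 1 < t / s.
  by rewrite -subr_lt0 tp pmulr_llt0 ?invr_gt0.
have := reverse_hoelder_sum n0 ts (fun i => powR_gt0 s (y0 i))
  (fun i => powR_gt0 p (a0 i)).
rewrite tp => H.
have {}H : (\sum_i y i `^ s) `^ (t / s) * (\sum_i a i `^ p) `^ (t / p) <=
    \sum_i (a i * y i) `^ t.
  apply: le_trans H _; apply: ler_sum => i _.
  rewrite powRM ?(ltW (a0 i)) ?(ltW (y0 i))// -!powRrM.
  rewrite mulrCA mulfV// mulr1 mulrCA mulfV// mulr1.
  by rewrite mulrC.
have i0 := Ordinal n0.
have ti : t^-1 <= 0 by rewrite invr_le0 ltW.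
have Y0 := sum_powR_gt0 s (y0 i0); have A0 := sum_powR_gt0 p (a0 i0).
rewrite [leRHS]mulrC -(powR_prodK s p tn (ltW Y0) (ltW A0)).
by apply: le_powR_neg ti _ H; rewrite mulr_gt0 ?powR_gt0.
Qed.

(** For this [y], both y^s and (a y)^t equal a^p, so the three weights are powers of one sum. Either
    sign alternative ensures that they are given by the power-sum formula. *)
Lemma rholder_hoelder_eq (p s t : R) a :
  p != 0 -> s != 0 -> t != 0 -> t^-1 = p^-1 + s^-1 ->
  (exists i, 0 < a i) -> (forall i, 0 <= a i) ->
  [/\ 0 < p, 0 < s & 0 < t] \/ (forall i, 0 < a i) ->
  let y i := a i `^ (p / s) in
  0 < rholder s%:E y /\
  rholder t%:E (fun i => a i * y i) = rholder p%:E a * rholder s%:E y.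
Proof.
move=> pn sn tn e [i0 ai0] a0 pos y.
have yE i : y i `^ s = a i `^ p by rewrite -powRrM divfK.
have ayE i : (a i * y i) `^ t = a i `^ p.
  rewrite powRM ?powR_ge0// -powRrM.
  have pE : t + p / s * t = p.
    transitivity (t * p * (p^-1 + s^-1)); first by field; rewrite pn sn.
    by rewrite -e mulrAC mulfV// mul1r.
  by rewrite -powRD pE// (negbTE pn).
have S0 : 0 < \sum_i a i `^ p by exact: sum_powR_gt0 ai0.
have [-> -> ->] : [/\ rholder s%:E y = (\sum_i a i `^ p) `^ s^-1,
    rholder t%:E (fun i => a i * y i) = (\sum_i a i `^ p) `^ t^-1 &
    rholder p%:E a = (\sum_i a i `^ p) `^ p^-1].
  have s1 : \sum_i y i `^ s = \sum_i a i `^ p by exact: eq_bigr.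
  have s2 : \sum_i (a i * y i) `^ t = \sum_i a i `^ p by exact: eq_bigr.
  case: pos => [[p0 s0 t0]|a1].
    rewrite (rholder_fin_pos _ p0) (rholder_fin_pos _ s0) (rholder_fin_pos _ t0).
    by rewrite s1 s2.
  have y1 i : 0 < y i by exact: powR_gt0.
  have ay1 i : 0 < a i * y i by rewrite mulr_gt0.
  rewrite (rholder_fin_neg _ a1) (rholder_fin_neg _ y1) (rholder_fin_neg _ ay1).
  by rewrite s1 s2.
split; first exact: powR_gt0.
by rewrite e; apply: powRD; rewrite (gt_eqF S0) implybT.
Qed.

Lemma rholder_basis p (i : 'I_n) : (0 < p)%E ->
  rholder p (fun j => (j == i)%:R) = 1.
Proof.
case: p => [r||]//; last first.
  move=> _; apply/eqP; rewrite eq_le; apply/andP; split.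
    by apply: rholdery_le => // j; case: (_ == _).
  by have := le_rholdery (fun j => (j == i)%:R) i; rewrite eqxx.
rewrite lte_fin => r0; rewrite rholder_fin_pos// (bigD1 i)//= big1 => [|j ji].
  by rewrite eqxx !powR1 addr0 powR1.
by rewrite (negbTE ji) powR0// gt_eqF.
Qed.

End RealHolder.

Arguments rholder : simpl never.

(** * From complex vectors to moduli, and the operator weight *)

Definition absv {R : realType} {n : nat} (x : 'cV[R[i]]_n) : 'I_n -> R :=
  fun i => Normc.normc (x i 0).

Section OperatorWeight.
Context {R : realType}.

Lemma normc_eq0 (z : R[i]) : (Normc.normc z == 0) = (z == 0).
Proof.
apply/eqP/eqP => [|->]; [exact: Normc.eq0_normc|exact: Normc.normc0].
Qed.

Lemma absv_ge0 n (x : 'cV[R[i]]_n) i : 0 <= absv x i.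
Proof. by rewrite /absv; case: (x i 0) => c d; rewrite sqrtr_ge0. Qed.

Lemma normc_real (c : R) : 0 <= c -> Normc.normc c%:C = c.
Proof.
by move=> c0; rewrite /Normc.normc/= expr0n addr0 sqrtr_sqr ger0_norm.
Qed.

Lemma absv_real n (a : 'I_n -> R) : (forall i, 0 <= a i) ->
  absv (\col_i (a i)%:C) = a.
Proof.
by move=> a0; apply/funext => i; rewrite /absv mxE normc_real.
Qed.

Lemma holderE n (p : \bar R) (x : 'cV[R[i]]_n) : (0 < n)%N ->
  holder p x = (rholder p (absv x))%:E.
Proof.
move=> n0; case: p => [r||]; rewrite /rholder/=.
- have -> : (\prod_i x i 0 == 0) = [exists i, absv x i == 0].
    apply/prodf_eq0/existsP => [[i _ xi]|[i xi]]; exists i => //.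
      by rewrite normc_eq0.
    by rewrite -normc_eq0.
  by case: ifP.
- exact: EFin_bigmax.
(* The minimum over a nonempty index set is attained, so starting it at [+oo] or at the maximum
   gives the same value. *)
- apply/eqP; rewrite eq_le; apply/andP; split; last first.
    apply: le_bigmin => [|i _]; first exact: leey.
    by rewrite lee_fin (rholderNy_le (absv x)).
  have [i _ E] : {i | i \in predT &
      \big[mine/+oo%E]_i (absv x i)%:E = (absv x i)%:E}.
    by apply: (eq_bigmin (Ordinal n0)) => // i _; exact: leey.
  rewrite [leLHS]E lee_fin; apply: le_rholderNy => // j.
  by rewrite -lee_fin -E; exact: bigmin_le.
Qed.

Lemma rholderZ n (p : \bar R) (c : R) (a : 'I_n -> R) : (0 < n)%N ->
  p != 0%E -> 0 <= c -> (forall i, 0 <= a i) ->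
  rholder p (fun i => c * a i) = c * rholder p a.
Proof.
move=> n0 p0 c0 a0; have [_ _ hZ] := holder_weight n0 p0.
have := hZ c%:C (\col_i (a i)%:C).
rewrite !holderE// absv_real// normc_real// => -[<-].
congr rholder; apply/funext => i.
by rewrite /absv !mxE Normc.normcM !normc_real.
Qed.

Lemma operator_weight_eq (X Y : lmodType R[i]) (wX : X -> \bar R)
    (wY : Y -> \bar R) (F : {linear X -> Y}) (c : R) :
  0 <= c -> (forall x, (0 <= wX x)%E) ->
  (forall x, (wY (F x) <= c%:E * wX x)%E) ->
  (forall C, 0 < C -> (forall x, (wY (F x) <= C%:E * wX x)%E) -> c <= C) ->
  operator_weight wX wY F = c%:E.
Proof.
move=> c0 wX0 bound tight; apply/eqP; rewrite eq_le; apply/andP; split.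
  (* Admissible constants are positive while [c] may be 0, hence the approximation by [c + e]. *)
  apply/lee_addgt0Pr => e e0; apply: ereal_inf_lbound.
  exists (c + e); last by rewrite EFinD.
  split; first by rewrite ltr_wpDl.
  move=> x; apply: le_trans (bound x) _; apply: lee_wpmul2r => //.
  by rewrite lee_fin lerDl ltW.
apply: le_ereal_inf_tmp => _ [C [C0 HC] <-].
by rewrite lee_fin; exact: tight.
Qed.

(** * The diagonal map in each range of exponents *)

Section Diagonal.
Context (n : nat) (v : 'cV[R[i]]_n) (s t : \bar R) (n0 : (0 < n)%N).

Let D : {linear 'cV[R[i]]_n -> 'cV[R[i]]_n} := mulmx (diag_mx v^T).

Lemma absv_diag x : absv (D x) = fun i => absv v i * absv x i.
Proof.
apply/funext => i; rewrite /absv /D/= mul_diag_mx !mxE.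
exact: Normc.normcM.
Qed.

(** Both weights depend on moduli only, and every nonnegative real vector is a vector of moduli. *)
Lemma diag_boundP (C : R) :
  (forall x, (holder t (D x) <= C%:E * holder s x)%E) <->
  (forall y, (forall i, 0 <= y i) ->
    rholder t (fun i => absv v i * y i) <= C * rholder s y).
Proof.
split=> [H y y0|H x].
  have := H (\col_i (y i)%:C).
  by rewrite !holderE// absv_diag absv_real// -EFinM lee_fin.
by rewrite !holderE// absv_diag -EFinM lee_fin; apply: H => i; exact: absv_ge0.
Qed.

Lemma diag_weight_eq (c : R) : 0 <= c ->
  (forall y, (forall i, 0 <= y i) ->
    rholder t (fun i => absv v i * y i) <= c * rholder s y) ->
  (forall C, 0 < C -> (forall y, (forall i, 0 <= y i) ->
    rholder t (fun i => absv v i * y i) <= C * rholder s y) -> c <= C) ->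
  operator_weight (holder s) (holder t) D = c%:E.
Proof.
move=> c0 bound tight; apply: operator_weight_eq => //.
- move=> x; rewrite holderE// lee_fin rholder_ge0// => i; exact: absv_ge0.
- exact/diag_boundP.
- by move=> C C0 /diag_boundP; exact: tight.
Qed.

(** Equality at a vector of positive weight excludes every smaller constant, since that weight
    cancels. *)
Lemma diag_weight_attained (c : R) y : 0 <= c ->
  (forall y, (forall i, 0 <= y i) ->
    rholder t (fun i => absv v i * y i) <= c * rholder s y) ->
  (forall i, 0 <= y i) -> 0 < rholder s y ->
  rholder t (fun i => absv v i * y i) = c * rholder s y ->
  operator_weight (holder s) (holder t) D = c%:E.
Proof.
move=> c0 bound y0 sy tight; apply: diag_weight_eq => // C C0 /(_ y y0).
by rewrite tight ler_pM2r.
Qed.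

(** The basis vector at [i] has [s]-weight 0 because its entry at [j] vanishes, but its image has
    [t]-weight |v_i| > 0: no constant is admissible. *)
Lemma diag_weight_infty i j : i != j -> (s < 0 < t)%E -> v i 0 != 0 ->
  operator_weight (holder s) (holder t) D = +oo%E.
Proof.
move=> ij /andP[s0 t0] vi; apply/eqP; rewrite -leye_eq.
apply: le_ereal_inf_tmp => _ [C [C0 /diag_boundP HC] <-].
have := HC (fun k => (k == i)%:R) (fun k => ler0n _ _).
rewrite (@rholder_zero _ _ s _ j) ?ler0n//; last first.
  by rewrite eq_sym (negbTE ij).
rewrite mulr0 [X in rholder t X](_ : _ =
    (fun k => absv v i * (k == i)%:R)); last first.
  by apply/funext => k; case: eqP => [->//|]; rewrite !mulr0.
rewrite rholderZ ?gt_eqF ?absv_ge0// rholder_basis// mulr1.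
move=> le0; have : absv v i == 0 by rewrite eq_le le0 absv_ge0.
by rewrite normc_eq0 (negbTE vi).
Qed.

Lemma diag_weight_zero :
  (forall y, (forall i, 0 <= y i) -> rholder t (fun i => absv v i * y i) = 0) ->
  operator_weight (holder s) (holder t) D = 0%E.
Proof.
move=> H; apply: diag_weight_eq => // [y y0|C C0 _]; last exact: ltW.
by rewrite H// mul0r.
Qed.

Let a := absv v.
Let a_ge0 i : 0 <= a i. Proof. exact: absv_ge0. Qed.

Lemma diag_weight_singular i : (t < 0)%E -> v i 0 = 0 ->
  operator_weight (holder s) (holder t) D = 0%E.
Proof.
move=> t0 vi; apply: diag_weight_zero => y y0.
apply: (@rholder_zero _ _ t _ i) => // [j|]; first by rewrite mulr_ge0 ?absv_ge0.
by rewrite /absv vi Normc.normc0 mul0r.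
Qed.

(** Entrywise a y <= (max y) a, with equality for the constant vector 1. *)
Lemma diag_weight_domain_infty : s = +oo%E -> t != 0%E ->
  operator_weight (holder s) (holder t) D = (rholder t a)%:E.
Proof.
move=> sE tn.
have one : rholder s (fun _ : 'I_n => 1 : R) = 1.
  apply/eqP; rewrite sE eq_le rholdery_le//=.
  exact: (le_rholdery (fun _ : 'I_n => 1) (Ordinal n0)).
apply: (@diag_weight_attained _ (fun=> 1)) => //.
- exact: rholder_ge0.
- move=> y y0; rewrite sE; have m0 : 0 <= rholder +oo%E y by exact: rholder_ge0.
  rewrite mulrC -rholderZ//; apply: rholder_le => // i.
  by rewrite mulr_ge0//= mulrC ler_wpM2r ?le_rholdery.
- by rewrite one.
rewrite one mulr1; congr rholder; apply/funext => i; exact: mulr1.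
Qed.

(** Serves case (C). For negative [t'] exactly one of [p] and [s'] is positive; if it is [s'], the
    two factors are exchanged before the negative Hölder bound is applied. *)
Lemma diag_weight_exponent (s' t' p : R) : s = s'%:E -> t = t'%:E ->
  p != 0 -> s' != 0 -> t' != 0 -> t'^-1 = p^-1 + s'^-1 ->
  [/\ 0 < p, 0 < s' & 0 < t'] /\ (exists i, v i 0 != 0) \/
  [/\ t' < 0, (0 < p) (+) (0 < s') & (forall i, v i 0 != 0)] ->
  operator_weight (holder s) (holder t) D = (rholder p%:E a)%:E.
Proof.
move=> sE tE pn sn tn e pos.
have a_gt0 i : (0 < a i) = (v i 0 != 0).
  by rewrite lt_def a_ge0 andbT /a /absv normc_eq0.
have exi : exists i, 0 < a i.
  case: pos => [[_ [i vi]]|[_ _ vi]]; first by exists i; rewrite a_gt0.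
  by exists (Ordinal n0); rewrite a_gt0.
have pos' : [/\ 0 < p, 0 < s' & 0 < t'] \/ (forall i, 0 < a i).
  by case: pos => [[]|[_ _ vi]]; [left|right=> i; rewrite a_gt0].
have [sy tight] := rholder_hoelder_eq pn sn tn e exi a_ge0 pos'.
rewrite -sE -tE in sy tight.
have p_ge0 : 0 <= rholder p%:E a by exact: rholder_ge0.
apply: diag_weight_attained sy tight => //; last first.
  by move=> i; exact: powR_ge0.
move=> y y0; rewrite sE tE; case: pos => [[[p0 s0 t0] _]|[t0 ps vn0]].
  exact: rholder_hoelder_pos.
have [[i yi]|/forallNP yn] := pselect (exists i, y i = 0).
  rewrite (@rholder_zero _ _ t'%:E _ i) ?yi ?mulr0 ?lte_fin//.
    exact: mulr_ge0 p_ge0 (rholder_ge0 _ y0).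
  by move=> j; rewrite mulr_ge0//; exact: a_ge0.
have y1 i : 0 < y i by rewrite lt_def y0 andbT; apply/eqP; exact: yn.
have a1 i : 0 < a i by rewrite a_gt0.
have [p0|p0] := ltP 0 p.
  move: ps; rewrite p0/= -leNgt le_eqVlt (negbTE sn) => s0.
  exact: rholder_hoelder_neg.
move: ps; rewrite ltNge p0/= => s0.
have {}p0 : p < 0 by rewrite lt_def eq_sym pn.
rewrite [X in rholder _ X <= _](_ : _ = fun i => y i * a i); last first.
  by apply/funext => i; rewrite mulrC.
by rewrite mulrC; apply: rholder_hoelder_neg => //; rewrite addrC.
Qed.

(** The upper bound is common to both half-lines; tightness stays a hypothesis because each needs
    its own test vectors. *)
Lemma diag_weight_max : (0 < s <= t)%E || (s <= t < 0)%E ->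
  (forall C, 0 < C -> (forall y, (forall i, 0 <= y i) ->
    rholder t (fun i => a i * y i) <= C * rholder s y) -> forall i, a i <= C) ->
  operator_weight (holder s) (holder t) D = (rholder +oo%E a)%:E.
Proof.
move=> st tight; have a_max0 : 0 <= rholder +oo%E a by exact: rholder_ge0.
have tn : t != 0%E.
  case/orP: st => /andP[h k]; last by rewrite lt_eqF.
  by rewrite gt_eqF// (lt_le_trans h k).
apply: diag_weight_eq => // [y y0|C C0 HC]; last first.
  by apply: rholdery_le => [|i]; [exact: ltW|exact: tight].
apply: le_trans (ler_wpM2l a_max0 (rholder_le_exponent n0 y0 st)).
rewrite -rholderZ//; apply: rholder_le => // i.
by rewrite mulr_ge0//= ?a_ge0// ler_wpM2r ?le_rholdery.
Qed.

Lemma diag_weight_max_pos : (0 < s <= t)%E ->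
  operator_weight (holder s) (holder t) D = (rholder +oo%E a)%:E.
Proof.
move=> st; apply: diag_weight_max; rewrite ?st// => C C0 HC i.
have /andP[s0 /(lt_le_trans s0) t0] := st.
have := HC (fun k => (k == i)%:R) (fun k => ler0n _ _).
rewrite [X in rholder t X](_ : _ = (fun k => a i * (k == i)%:R)); last first.
  by apply/funext => k; case: eqP => [->//|]; rewrite !mulr0.
by rewrite rholderZ ?gt_eqF ?a_ge0// !rholder_basis// !mulr1.
Qed.

(* The infimum need not be reached on a single vector: [a i <= C] comes from
   vectors that are [1] at [i] and tend to infinity elsewhere. *)
Lemma diag_weight_max_neg (t' : R) : t = t'%:E -> (s <= t < 0)%E ->
  (forall i, v i 0 != 0) ->
  operator_weight (holder s) (holder t) D = (rholder +oo%E a)%:E.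
Proof.
move=> tE st vn0; apply: diag_weight_max; rewrite ?st ?orbT// => C C0 HC i.
have a1 j : 0 < a j by rewrite lt_def a_ge0 andbT /a /absv normc_eq0.
have t0 : t' < 0 by case/andP: st; rewrite tE lte_fin.
have tn : t' != 0 by rewrite lt_eqF.
have sn : (s < 0)%E by case/andP: st => /le_lt_trans; apply.
rewrite leNgt; apply/negP => Ca.
have dlt : a i `^ t' < C `^ t'.
  rewrite -(opprK t') !(powRN _ (- t')) ltf_pV2 ?posrE ?powR_gt0//.
  by apply: gt0_ltr_powR; rewrite ?oppr_gt0 ?nnegrE// ltW.
set S := \sum_j a j `^ t'; have S0 : 0 < S by exact: sum_powR_gt0 (a1 i).
(* Chosen so that K^t' S is the gap C^t' - a_i^t', positive because C < a_i and t' < 0. *)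
set K := ((C `^ t' - a i `^ t') / S) `^ t'^-1.
have KE : K `^ t' = (C `^ t' - a i `^ t') / S.
  by rewrite powRVK// divr_ge0 ?(ltW S0)// subr_ge0 ltW.
have K0 : 0 < K by rewrite powR_gt0// divr_gt0// subr_gt0.
pose y j := if j == i then 1 else K.
have y0 j : 0 < y j by rewrite /y; case: ifP.
have sy : rholder s y <= 1.
  apply: (@le_trans _ _ (rholder -oo%E y)).
    apply: rholder_le_exponent => // [j|]; first exact: ltW.
    by rewrite leNye sn orbT.
  by have := rholderNy_le y i; rewrite /y eqxx.
have ay0 j : 0 < a j * y j by rewrite mulr_gt0.
have : rholder t'%:E (fun j => a j * y j) <= C.
  rewrite -tE; apply: le_trans (HC y (fun j => ltW (y0 j))) _.
  by rewrite ger_pMr.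
have h0 : 0 < rholder t'%:E (fun j => a j * y j) by exact: rholder_gt0.
move=> /(le_powR_neg (ltW t0) h0).
rewrite (rholder_fin_neg _ ay0) powRVK ?sum_powR_ge0//.
apply/negP; rewrite -ltNge (bigD1 i)//= {1}/y eqxx mulr1.
rewrite -ltrBrDl; apply: (@lt_le_trans _ _ (K `^ t' * S)); last first.
  by rewrite KE divfK// gt_eqF.
(* [S] includes the index [i], which the remaining sum omits; this makes the inequality strict. *)
rewrite /S [X in _ < _ * X](bigD1 i)//= mulrDr.
apply: ltr_pwDl; first exact: mulr_gt0 (powR_gt0 _ K0) (powR_gt0 _ (a1 i)).
rewrite mulr_sumr; apply: ler_sum => j ji.
by rewrite /y (negbTE ji) powRM ?(ltW (a1 j)) ?(ltW K0)// mulrC.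
Qed.

(** With m the minimum of a y, entrywise m/a <= y; the weight of 1/a is known by duality, and at y =
    1/a the product a y is constantly 1. *)
Lemma diag_weight_codomain_Ninfty : s != 0%E -> t = -oo%E ->
  (forall i, v i 0 != 0) ->
  operator_weight (holder s) (holder t) D = (rholder (- s)%E a)%:E.
Proof.
move=> sn tE vn0.
have a1 j : 0 < a j by rewrite lt_def a_ge0 andbT /a /absv normc_eq0.
pose z i := (a i)^-1; have z0 i : 0 < z i by rewrite invr_gt0.
have c0 : 0 < rholder (- s)%E a by exact: rholder_gt0.
have sz : rholder s z = (rholder (- s)%E a)^-1.
  by rewrite -(rholderV _ n0 a1) oppeK.
apply: (@diag_weight_attained _ z) => //; first exact: ltW.
- move=> y y0; rewrite tE; set m := rholder -oo%E _.
  have m0 : 0 <= m by apply: rholder_ge0 => i; rewrite mulr_ge0.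
  rewrite -ler_pdivrMl// mulrC -sz -rholderZ//; last by move=> i; exact: ltW.
  apply: rholder_le => // i; rewrite mulr_ge0 ?(ltW (z0 i))//=.
  by rewrite ler_pdivrMr// mulrC; exact: (rholderNy_le (fun i => a i * y i)).
- by move=> i; exact: ltW.
- by rewrite sz invr_gt0.
rewrite tE sz mulfV ?gt_eqF//.
rewrite [X in rholder _ X](_ : _ = fun=> 1); last first.
  by apply/funext => i; rewrite mulfV ?gt_eqF.
apply/eqP; rewrite eq_le le_rholderNy// andbT.
exact: (rholderNy_le (fun _ : 'I_n => 1) (Ordinal n0)).
Qed.

End Diagonal.
End OperatorWeight.

(** * Exhaustiveness of the cases and their values *)

Lemma holder0 (R : realType) n (p : \bar R) : (0 < n)%N -> p != 0%E ->
  holder p (0 : 'cV[R[i]]_n) = 0%E.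
Proof. by move=> n0 p0; case: (holder_weight n0 p0). Qed.

Lemma cV_neq0P (K : nzRingType) n (v : 'cV[K]_n) :
  v <> 0 -> exists i, v i 0 != 0.
Proof.
move=> v0; apply/existsP; apply: contra_notT v0 => /existsPn v0.
by apply/matrixP => i j; rewrite (ord1 j) mxE; exact/eqP/negPn/v0.
Qed.

Theorem theorem1 (R : realType) (n : nat) (hn : (2 <= n)%N)
    (v : 'cV[R[i]]_n) (s t : \bar R) (hs : s != 0%E) (ht : t != 0%E) :
  let D : 'M[R[i]]_n := diag_mx v^T in
  let normD := operator_weight (holder s) (holder t)
                 (mulmx D : {linear 'cV[R[i]]_n -> 'cV[R[i]]_n}) in
  let prodv : R[i] := \prod_(i < n) v i 0 in
  let caseA := (s < 0 < t)%E /\ v <> 0 in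
  let caseB := v = 0 \/ ((t < 0)%E /\ prodv = 0) \/ s = +oo%E in
  let caseC :=
    [/\ (-oo < t)%E, (t < s < 0)%E & prodv <> 0] \/
    ((0 < t)%E /\ (t < s < +oo)%E) \/
    ((-oo < t < 0)%E /\ (0 < s < +oo)%E) in
  let caseD := ((s <= t < 0)%E /\ prodv <> 0) \/ (0 < s <= t)%E in
  let caseE := t = -oo%E /\ prodv <> 0 in
  [\/ caseA, caseB, caseC | caseD \/ caseE] /\
  [/\ caseA -> normD = +oo%E,
      caseB -> normD = holder t v,
      caseC -> normD = holder (s * t / (s - t))%E v,
      caseD -> normD = holder +oo%E v &
      caseE -> normD = holder (- s)%E v].
Proof.
move=> D normD prodv caseA caseB caseC caseD caseE.
have n0 : (0 < n)%N by exact: ltnW.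
have prod0 : prodv = 0 -> exists i, v i 0 = 0.
  by move=> /eqP/prodf_eq0[i _ /eqP vi]; exists i.
have prodn0 : prodv <> 0 -> forall i, v i 0 != 0.
  by move=> /eqP/prodf_neq0 h i; exact: h.
have hE p : holder p v = (rholder p (absv v))%:E by exact: holderE.
(* Besides (B), this serves (C) with [s > 0], where [v = 0] is allowed and the extremal vector
   a^(p/s) degenerates. *)
have v0D : v = 0 -> normD = 0%E.
  move=> v0; apply: diag_weight_zero => // y _.
  rewrite (_ : (fun i => _) = absv (0 : 'cV[R[i]]_n)).
    by apply/EFin_inj; rewrite -holderE// holder0.
  by apply/funext => i; rewrite v0 /absv mxE Normc.normc0 mul0r.
(* Used for (B) with [p = t], and for (C) with t < 0 < s and a zero product, where st/(s-t) is
   negative and both sides vanish. *)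
have singularE p : (t < 0)%E -> (p < 0)%E -> prodv = 0 -> normD = holder p v.
  move=> t0 p0 /prod0[i vi]; rewrite /normD (diag_weight_singular _ n0 t0 vi) hE.
  rewrite (@rholder_zero _ _ p _ i) => // [j|]; first exact: absv_ge0.
  by rewrite /absv vi Normc.normc0.
split.
  have [v0|/eqP v0] := eqVneq v 0; first by constructor 2; left.
  have [sy|sny] := eqVneq s +oo%E; first by constructor 2; right; right.
  have s_lty : (s < +oo)%E by rewrite ltey.
  have [s0|s0|] := ltgtP s 0%E; last by move/eqP; rewrite (negbTE hs).
    have [t0|t0|] := ltgtP t 0%E; last by move/eqP; rewrite (negbTE ht).
      have [p0|/eqP p0] := eqVneq prodv 0; first by constructor 2; right; left.
      have [st|ts] := leP s t; first by constructor 4; left; left; rewrite st t0.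
      have [tE|tn] := eqVneq t -oo%E; first by constructor 4; right.
      by constructor 3; left; split=> //; rewrite ?ltNye ?ts ?s0.
    by constructor 1; split=> //; rewrite s0 t0.
  have [t0|t0|] := ltgtP t 0%E; last by move/eqP; rewrite (negbTE ht).
    have [p0|/eqP p0] := eqVneq prodv 0; first by constructor 2; right; left.
    have [tE|tn] := eqVneq t -oo%E; first by constructor 4; right.
    by constructor 3; right; right; rewrite ltNye tn t0 s0 s_lty.
  have [st|ts] := leP s t; first by constructor 4; left; right; rewrite s0 st.
  by constructor 3; right; left; rewrite t0 ts s_lty.
split.
- move=> [st /cV_neq0P[i vi]].
  (* A second index exists because n >= 2. *)
  have [j ij] : exists j, i != j.
    have /card_gt0P[j] : (0 < #|predC1 i|)%N.
      by rewrite cardC1 card_ord -ltnS prednK.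
    by rewrite !inE eq_sym; exists j.
  exact: diag_weight_infty ij st vi.
- case=> [v0|[[t0 p0]|sE]]; first by rewrite v0D// v0 holder0.
    exact: singularE.
  by rewrite hE; exact: diag_weight_domain_infty.
- move=> HC.
  (* Each alternative of (C) forces t < s with both finite, so only real exponents and their signs
     matter. *)
  have [s' [t' [sE tE ts sgn]]] : exists s' t', [/\ s = s'%:E, t = t'%:E, t' < s' &
      [\/ 0 < t', s' < 0 /\ prodv <> 0 | t' < 0 < s']].
    have [tNy [ts sy]] : (-oo < t)%E /\ (t < s)%E /\ (s < +oo)%E.
      case: HC => [[tNy /andP[ts s0] _]|
        [[t0 /andP[ts sy]]|[/andP[tNy t0] /andP[s0 sy]]]].
      - by split=> //; split=> //; exact: lt_trans s0 (ltry 0).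
      - by split; [exact: lt_trans (ltNyr 0) t0|].
      - by split=> //; split=> //; exact: lt_trans s0.
    have sf : s \is a fin_num by rewrite fin_real// sy (lt_trans tNy).
    have tf : t \is a fin_num by rewrite fin_real// tNy (lt_trans ts).
    exists (fine s), (fine t); rewrite !fineK//; split=> //.
      by rewrite -lte_fin !fineK.
    rewrite -!lte_fin !fineK//.
    case: HC => [[_ /andP[_ s0] p0]|[[t0 _]|[/andP[_ t0] /andP[s0 _]]]].
    - by constructor 2.
    - by constructor 1.
    - by constructor 3; rewrite t0 s0.
  have sn : s' != 0 by move: hs; rewrite sE eqe.
  have tn : t' != 0 by move: ht; rewrite tE eqe.
  have d0 : 0 < s' - t' by rewrite subr_gt0.
  have dn : s' - t' != 0 by rewrite gt_eqF.
  (* The solution of 1/t = 1/p + 1/s; as s > t, its sign is that of st. *)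
  set p := s' * t' / (s' - t').
  have pE : (s * t / (s - t))%E = p%:E.
    by rewrite sE tE -EFinB inver (negbTE dn) -!EFinM.
  have pn : p != 0 by rewrite !mulf_neq0 ?invr_eq0.
  have e : t'^-1 = p^-1 + s'^-1 by rewrite /p; field; rewrite sn tn dn.
  rewrite pE; have [v0|/eqP/cV_neq0P vn0] := eqVneq v 0.
    by rewrite v0D// v0 holder0.
  have exponentE := diag_weight_exponent n0 sE tE pn sn tn e.
  case: sgn => [t0|[s0 /prodn0 v_neq0]|/andP[t0 s0]].
  + have s0 : 0 < s' by exact: lt_trans ts.
    by rewrite hE; apply: exponentE; left; rewrite !divr_gt0 ?mulr_gt0.
  + have t0 : t' < 0 by exact: lt_trans s0.
    rewrite hE; apply: exponentE; right; split=> //.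
    by rewrite divr_gt0 ?nmulr_rgt0// ltNge (ltW s0).
  + have p0 : p < 0 by rewrite pmulr_llt0 ?invr_gt0// pmulr_rlt0.
    have [q0|/eqP/prodn0 q0] := eqVneq prodv 0.
      by apply: singularE; rewrite ?tE ?lte_fin.
    rewrite hE; apply: exponentE; right; split=> //.
    by rewrite s0 ltNge (ltW p0).
- case=> [[st /prodn0 vn0]|st]; rewrite hE; last exact: diag_weight_max_pos.
  have [[t' tE]|tE] : (exists t', t = t'%:E) \/ t = -oo%E.
    by case: (t) st => [t'||]; [left; exists t'|move=> /andP[]|right].
  + exact: diag_weight_max_neg tE st vn0.
  (* Here [s] is [-oo] too, so the maximum is the weight of exponent [- s], as in (E). *)
  + have sE : s = -oo%E by apply/eqP; rewrite -leeNy_eq -tE; case/andP: st.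
    by rewrite -[+oo%E]/(- -oo)%E -sE; exact: diag_weight_codomain_Ninfty.
- by move=> [tE /prodn0 vn0]; rewrite hE; exact: diag_weight_codomain_Ninfty.
Qed.
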